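(* Let $G$ be a countable locally finite abelian group (written additively) for which $2G=\{2g:g\in G\}$ is finite, and let $G_\bullet=(G_i)_{i\ge1}$ be any filtration of $G$ by finite subgroups. For every $A\subseteq G$ there exists $m\in\mathbb Z_{\ge0}\cup\{\infty\}$ such that $$\frac{2^{-m}}{|2G|}\le\underline d_{G_\bullet}\bigl(\mathcal P(A)\bigr)\le\overline d_{G_\bullet}\bigl(\mathcal P(A)\bigr)\le2^{-m},$$ where $2^{-\infty}:=0$. In particular, $$\overline d_{G_\bullet}\bigl(\mathcal P(A)\bigr)>\tfrac12\quad\Longrightarrow\quad\underline d_{G_\bullet}\bigl(\mathcal P(A)\bigr)\ge\frac1{|2G|}.$$
   Context: An abelian group is locally finite if every finitely generated subgroup is finite. A filtration of $G$ by finite subgroups is a chain $G_1\le G_2\le\cdots$ of finite subgroups with $\bigcup_{i\ge1}G_i=G$. For $A\subseteq G$, $\mathcal P(A):=\{\sum_{a\in F}a : F\subseteq A,\ |F|<\infty\}$ is the set of finite subset sums, including the empty sum $0$. For $S\subseteq G$: $d_i^{G_\bullet}(S):=|S\cap G_i|/|G_i|$, $\underline d_{G_\bullet}(S):=\liminf_{i\to\infty}d_i^{G_\bullet}(S)$, $\overline d_{G_\bullet}(S):=\limsup_{i\to\infty}d_i^{G_\bullet}(S)$. *)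

(* Defs.v *)
From HB Require Import structures.
From mathcomp Require Import all_boot all_order all_algebra finmap.
From mathcomp Require Import all_classical all_reals all_analysis.

Set Implicit Arguments.
Unset Strict Implicit.
Unset Printing Implicit Defensive.

Import Order.TTheory GRing.Theory Num.Theory.

Local Open Scope classical_set_scope.
Local Open Scope ring_scope.

Definition subgroup (G : zmodType) (H : set G) : Prop := zmod_closed (mem H).

Definition generated_subgroup (G : zmodType) (X : set G) : set G :=
  smallest (@subgroup G) X.

Definition locally_finite (G : zmodType) : Prop :=
  forall X : set G, finite_set X -> finite_set (generated_subgroup X).

(* [Gf i] is the member of index i + 1 of a filtration indexed from 1. *)
Definition finite_filtration (G : zmodType) (Gf : nat -> set G) : Prop :=
  [/\ forall i, subgroup (Gf i) /\ finite_set (Gf i),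
      forall i, Gf i `<=` Gf i.+1 &
      \bigcup_i Gf i = [set: G]].

Definition subset_sums (G : zmodType) (A : set G) : set G :=
  [set (\sum_(a <- F) a)%R | F in [set F : {fset G} | [set` F] `<=` A]].

Definition doubles (G : zmodType) : set G := [set g *+ 2 | g in [set: G]].
Arguments doubles : clear implicits.

(* [fset_set] is meaningful on finite sets only; it is used below on subsets of
   the finite subgroups [Gf i] and on [doubles G] when the latter is finite. *)
Definition card_set (T : choiceType) (S : set T) : nat := #|` fset_set S|.

Definition density (R : realType) (G : zmodType) (Gf : nat -> set G)
    (S : set G) : R^nat :=
  fun i => (card_set (S `&` Gf i))%:R / (card_set (Gf i))%:R.

Definition lower_density (R : realType) (G : zmodType) (Gf : nat -> set G)
    (S : set G) : R := limn_inf (density R Gf S).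

Definition upper_density (R : realType) (G : zmodType) (Gf : nat -> set G)
    (S : set G) : R := limn_sup (density R Gf S).

(* 2^-m for m a natural number or infinity, the latter encoded by [None]. *)
Definition inv_pow2 (R : realType) (m : option nat) : R :=
  if m is Some k then 2 ^- k else 0.

(* Main.v *)
(* Let K be the subgroup generated by A.  Every element of K is a subset sum of
   A modulo 2K, so P(A) + 2K = K.  Put K_i = K meet G_i.  For large i one has
   2G_i = 2G and 2K_i = 2K, hence |G_i| = |2G| |G_i[2]| and |K_i| = |2K| |K_i[2]|,
   so that |K_i[2]| <= |P(A) meet G_i| <= |K_i| <= |2G| |K_i[2]|.  The index
   [G_i[2] : K_i[2]] is a power 2^(r_i), so the density of P(A) in G_i lies
   between 2^(-r_i) / |2G| and 2^(-r_i).  As r_i is nondecreasing, m is its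
   limit, possibly infinite. *)
Require Import Defs.
From mathcomp Require Import all_boot all_order all_algebra finmap.
From mathcomp Require Import all_classical all_reals all_analysis.

Import Order.TTheory GRing.Theory Num.Theory.
Local Open Scope classical_set_scope.
Local Open Scope ring_scope.

Set Implicit Arguments.
Unset Strict Implicit.
Unset Printing Implicit Defensive.
Local Open Scope fset_scope.
Local Open Scope classical_set_scope.
Local Open Scope ring_scope.

(** * Counting in finite subgroups *)

Lemma card_fset_image_inj (T T' : choiceType) (f : T -> T') (A : {fset T}) :
  injective f -> #|` [fset f x | x in A]| = #|` A|.
Proof. by move=> finj; rewrite card_imfset. Qed.

Lemma card_fsetM (T T' : choiceType) (A : {fset T}) (B : {fset T'}) :
  #|` (A `*` B)%fset| = (#|` A| * #|` B|)%N.
Proof.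
rewrite -(size_allpairs pair); apply/perm_size/uniq_perm; first exact: fset_uniq.
  by apply: allpairs_uniq => // -[? ?] [].
move=> [x y]; rewrite in_fsetM /=.
by apply/andP/allpairsP => [[xA yB]|[[_ _] [? ? [-> ->]]] //]; exists (x, y).
Qed.

(** Every nonempty fibre of [f] on [H] is a translate [x + ker], so all fibres have the size of the
    kernel. Applied below to doubling and to a difference map. *)
Lemma card_fset_image_kernel (U V : zmodType) (f : U -> V) (H : {fset U}) :
  zmod_closed (mem H) -> {morph f : x y / x - y} ->
  #|` H| = (#|` [fset f x | x in H]| * #|` [fset x in H | f x == 0%R]|)%N.
Proof.
move=> Hsub fB.
have [H0 HB] := Hsub; have [_ HD] := GRing.zmod_closedD Hsub.
have f0 : f 0 = 0 by rewrite -[0 in LHS](subrr 0) fB subrr.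
have fN x : f (- x) = - f x by rewrite -sub0r fB f0 sub0r.
have fD x y : f (x + y) = f x + f y by rewrite -[y in LHS]opprK fB fN opprK.
rewrite card_fset_sum1 (partition_big_imfset _ f) /=.
transitivity
  (\sum_(j <- [fset f x | x in H]) #|` [fset x in H | f x == 0%R]|)%N; last first.
  by rewrite big_const_seq count_predT iter_addn_0 mulnC.
apply: eq_big_seq => j /imfsetP[/= x xH ->].
rewrite big_fset_condE -card_fset_sum1.
rewrite -[RHS](card_fset_image_inj _ (addrI x)); congr #|` _|.
apply/fsetP => y; rewrite !inE; apply/andP/imfsetP => [[yH /eqP fxy]|].
  exists (y - x); last by rewrite addrC subrK.
  by rewrite !inE fB fxy subrr eqxx andbT; apply: HB.
move=> [z]; rewrite !inE => /andP[zH /eqP fz] ->.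
by rewrite fD fz addr0 eqxx; split => //; apply: HD.
Qed.

(** Build [H] up from the trivial subgroup by adjoining elements one at a time. Each new [x]
    satisfies [2x = 0], so it adds just the coset [x + S] and doubles the size. *)
Lemma card_fset_2torsion (G : zmodType) (H : {fset G}) :
  zmod_closed (mem H) -> {in H, forall x, x *+ 2 = 0} ->
  exists a, #|` H| = (2 ^ a)%N.
Proof.
move=> Hsub H2.
have oppH x : x \in H -> - x = x.
  by move=> /H2 x2; apply/eqP; rewrite eq_sym -addr_eq0 -mulr2n x2.
(* The induction runs over lists [s] of elements of [H], producing subgroups that contain [s];
   taking [s] to enumerate [H] forces [S = H]. *)
suff gen (s : seq G) : {subset s <= H} -> exists S : {fset G},
    [/\ zmod_closed (mem S), {subset s <= S}, {subset S <= H} &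
        exists a, #|` S| = (2 ^ a)%N].
  have [S [_ HS SH [a cS]]] := gen H (fun x xH => xH).
  exists a; rewrite -cS; congr #|` _|; apply/fsetP => x.
  by apply/idP/idP => [/HS|/SH].
have [H0 HB] := Hsub; have [_ HD] := GRing.zmod_closedD Hsub.
elim: s => [_|x s IHs sH].
  exists [fset 0]; split => //.
  - by split=> [|y z]; rewrite !inE // => /eqP -> /eqP ->; rewrite subrr.
  - by move=> y; rewrite inE => /eqP ->.
  - by exists 0%N; rewrite cardfs1.
have xH : x \in H by apply: sH; rewrite inE eqxx.
have [|S [Ssub sS SH [a cS]]] := IHs.
  by move=> y ys; apply: sH; rewrite inE ys orbT.
have [xS|xNS] := boolP (x \in S).
  exists S; split => //; last by exists a.
  by move=> y; rewrite inE => /orP[/eqP->|/sS].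
have [S0 SB] := Ssub; have [_ SD] := GRing.zmod_closedD Ssub.
have xx : x + x = 0 by rewrite -mulr2n H2.
(* Closure under subtraction uses [- x = x]: a difference of elements from different cosets lies in
   [x + S], one from the same coset in [S]. *)
exists (S `|` [fset (x + y)%R | y in S])%fset; split.
- split; first by rewrite /= in_fsetU S0.
  move=> u v; rewrite /= !in_fsetU.
  move=> /orP[uS|/imfsetP[/= u' uS ->]] /orP[vS|/imfsetP[/= v' vS ->]].
  + by rewrite SB.
  + apply/orP; right; apply/imfsetP; exists (u - v'); first exact: SB.
    by rewrite opprD (oppH x)// addrCA.
  + by apply/orP; right; apply/imfsetP; exists (u' - v); [exact: SB|rewrite addrA].
  + by rewrite opprD addrACA subrr add0r SB.
- move=> y; rewrite inE in_fsetU => /orP[/eqP->|/sS ->//].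
  by apply/orP; right; apply/imfsetP; exists 0; rewrite ?addr0.
- move=> y; rewrite in_fsetU => /orP[/SH//|/imfsetP[/= z /SH zH ->]].
  exact: HD.
- exists a.+1; rewrite cardfsU.
  (* A common element [y = x + z] would give [x = y - z] in [S]. *)
  have -> : (S `&` [fset (x + y)%R | y in S] = fset0)%fset.
    apply/fsetP => y; rewrite !inE; apply/negP => /andP[yS /imfsetP[/= z zS yE]].
    by move: xNS; rewrite (_ : x = y - z) ?SB// yE addrK.
  rewrite cardfs0 subn0 card_fset_image_inj; last exact: addrI.
  by rewrite cS expnS mul2n addnn.
Qed.

(** This is [[X : X meet Y] <= [Z : Y]] without quotients. The difference map on [X * Y] takes
    values in [Z], and its kernel is the diagonal copy of the intersection. *)
Lemma leq_card_fset_index (G : zmodType) (X Y Z : {fset G}) :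
  zmod_closed (mem X) -> zmod_closed (mem Y) -> zmod_closed (mem Z) ->
  {subset X <= Z} -> {subset Y <= Z} ->
  (#|` X| * #|` Y| <= #|` Z| * #|` (X `&` Y)%fset|)%N.
Proof.
move=> [X0 XB] [Y0 YB] [_ ZB] XZ YZ.
have XYsub : zmod_closed (mem (X `*` Y)%fset).
  split=> [|u v]; rewrite /= !in_fsetM /= ?X0//.
  by move=> /andP[uX uY] /andP[vX vY]; rewrite XB ?YB.
rewrite -card_fsetM.
rewrite (card_fset_image_kernel XYsub (f := fun p => p.1 - p.2)); last first.
  by move=> [u v] [u' v'] /=; rewrite [in LHS]opprD addrACA -opprD.
apply: leq_mul.
  apply/fsubset_leq_card/fsubsetP => z /imfsetP[/= [x y]].
  by rewrite in_fsetM => /andP[/= xX yY] -> /=; apply: ZB; [exact: XZ|exact: YZ].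
have injD : injective (fun x : G => (x, x)) by move=> y y' [].
rewrite -[leqRHS](card_fset_image_inj _ injD).
apply/fsubset_leq_card/fsubsetP => -[x y].
rewrite !inE /=; move=> /andP[/andP[/= xX yY]]; rewrite subr_eq0 => /eqP xy.
by rewrite -xy in yY *; apply/imfsetP; exists x; rewrite /= ?in_fsetI ?xX.
Qed.

(** * Subset sums modulo doubles of the generated subgroup *)

Lemma subgroup_generated (G : zmodType) (A : set G) :
  subgroup (generated_subgroup A).
Proof.
split=> [|x y]; rewrite !inE.
  by move=> B [[B0 _] _]; rewrite inE in B0.
move=> Kx Ky B HB; have [[_ BB] _] := HB; have := BB x y.
by rewrite !inE => Bxy; apply: Bxy; [exact: Kx|exact: Ky].
Qed.

Lemma subset_sums_sub (G : zmodType) (A K : set G) :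
  subgroup K -> A `<=` K -> subset_sums A `<=` K.
Proof.
move=> Ksub AK _ [F /= FA <-]; rewrite big_seq.
have [_ KD] := GRing.zmod_closedD Ksub; have [K0 _] := Ksub.
rewrite -in_setE; apply: (big_ind (fun x => x \in K)) => // a aF.
by rewrite inE; apply/AK/FA.
Qed.

(* [s_E - s_F = s_(E symmetric difference F) - 2 s_(F minus E)], so the subset
   sums of [A] form a subgroup modulo [2K]. *)
Lemma subset_sumsB (G : zmodType) (A : set G) p q :
  subset_sums A p -> subset_sums A q ->
  exists r z, [/\ subset_sums A r, generated_subgroup A z & p - q = r + z *+ 2].
Proof.
have [K0 KB] := subgroup_generated A.
have PK := subset_sums_sub (subgroup_generated A) (@sub_gen_smallest _ _ A).
move=> [E /= EA <-] [F /= FA <-].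
set s := fun X : {fset G} => \sum_(a <- X) a.
have sID (X Y : {fset G}) : s X = s (X `&` Y)%fset + s (X `\` Y)%fset.
  rewrite /s (big_fsetID _ (mem Y))/=; congr (_ + _).
  - by apply: eq_fbigl => x; rewrite !inE.
  - by apply: eq_fbigl => x; rewrite !inE andbC.
exists (s ((E `\` F) `|` (F `\` E))%fset), (- s (F `\` E)%fset); split.
- exists ((E `\` F) `|` (F `\` E))%fset => //= x /=.
  by rewrite !inE => /orP[/andP[_ /EA]|/andP[_ /FA]].
- suff Ks : generated_subgroup A (s (F `\` E)%fset).
    have := KB 0 (s (F `\` E)%fset); rewrite sub0r !inE => KN; apply: KN => //.
    by rewrite inE in K0.
  by apply: PK; exists (F `\` E)%fset => //= x /=; rewrite inE => /andP[_ /FA].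
rewrite (sID (_ `|` _)%fset E).
have -> : ((E `\` F `|` F `\` E) `&` E = E `\` F)%fset.
  by apply/fsetP => x; rewrite !inE; case: (x \in E); case: (x \in F).
have -> : ((E `\` F `|` F `\` E) `\` E = F `\` E)%fset.
  by apply/fsetP => x; rewrite !inE; case: (x \in E); case: (x \in F).
rewrite -/(s E) -/(s F) (sID E F) (sID F E) fsetIC.
by rewrite [X in X - _ = _]addrC addrKA mulNrn mulr2n opprD addrA addrK.
Qed.

(** The elements of the form [p + 2z] form a subgroup [Q], by [subset_sumsB], and [Q] contains [A]
    through the singleton sums; hence it contains the generated subgroup. *)
Lemma generated_subgroup_mod2 (G : zmodType) (A : set G) x :
  generated_subgroup A x ->
  exists p z, [/\ subset_sums A p, generated_subgroup A z & x = p + z *+ 2].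
Proof.
have [K0 KB] := subgroup_generated A.
have KN z : generated_subgroup A z -> generated_subgroup A (- z).
  move=> Kz; have := KB 0 z; rewrite sub0r !inE => KN; apply: KN => //.
  by rewrite inE in K0.
have KD z t : generated_subgroup A z -> generated_subgroup A t ->
    generated_subgroup A (z + t).
  move=> Kz Kt; have := KB z (- t); rewrite opprK !inE => KD; apply: KD => //.
  exact: KN.
pose Q := [set x | exists p z,
  [/\ subset_sums A p, generated_subgroup A z & x = p + z *+ 2]].
have Qsub : subgroup Q.
  split=> [|u v]; rewrite !inE.
    exists 0, 0; split; last by rewrite mul0rn addr0.
    - by exists fset0 => //=; rewrite big_seq_fset0.
    - by rewrite inE in K0.
  move=> [p [z [Pp Kz ->]]] [q [t [Pq Kt ->]]].
  have [r [w [Pr Kw pq]]] := subset_sumsB Pp Pq.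
  exists r, (w + z - t); split => //.
    by apply: (KD); [apply: (KD)|apply: (KN)].
  by rewrite opprD addrACA pq -mulrnBl -addrA -mulrnDl [w + (z - t)]addrA.
apply: (smallest_sub Qsub) => a Aa; exists a, 0; split.
- exists [fset a]%fset; last by rewrite big_seq_fset1.
  by move=> b /=; rewrite inE => /eqP ->.
- by rewrite inE in K0.
- by rewrite mul0rn addr0.
Qed.

(** * Lower and upper limits of bounded real sequences *)

Lemma le_limn_inf (R : realType) (u : R^nat) c N :
  bounded_fun u -> (forall n, (N <= n)%N -> c <= u n) -> c <= limn_inf u.
Proof.
move=> ubnd cu; rewrite limn_infE//.
apply: (le_trans (y := infs u N)).
  by apply: lb_le_inf; [exists (u N), N => /=|move=> _ [n /= Nn <-]; apply: cu].
by apply: ub_le_sup; [exact: bounded_fun_has_ubound_infs|exists N].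
Qed.

Lemma limn_sup_le (R : realType) (u : R^nat) c N :
  bounded_fun u -> (forall n, (N <= n)%N -> u n <= c) -> limn_sup u <= c.
Proof.
move=> ubnd cu; rewrite limn_supE//.
apply: (le_trans (y := sups u N)).
  by apply: ge_inf; [exact: bounded_fun_has_lbound_sups|exists N].
by apply: ge_sup; [exists (u N), N => /=|move=> _ [n /= Nn <-]; apply: cu].
Qed.

Lemma limn_inf_le_sup (R : realType) (u : R^nat) :
  bounded_fun u -> limn_inf u <= limn_sup u.
Proof.
move=> ubnd; rewrite limn_supE//; apply: lb_le_inf; first by exists (sups u 0), 0%N.
move=> _ [n _ <-]; rewrite limn_infE//; apply: ge_sup; first by exists (infs u 0), 0%N.
have [[M uM] [m um]] := (bounded_fun_has_ubound ubnd, bounded_fun_has_lbound ubnd).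
(* The term at [maxn k n] lies in both tails, hence between the infimum of one and the supremum of
   the other. *)
move=> _ [k _ <-]; apply: (le_trans (y := u (maxn k n))).
  apply: ge_inf; last by exists (maxn k n); rewrite //= leq_maxl.
  by exists m => _ [j _ <-]; apply: um; exists j.
apply: ub_le_sup; last by exists (maxn k n); rewrite //= leq_maxr.
by exists M => _ [j _ <-]; apply: uM; exists j.
Qed.

(** * Stabilisation of doubles and cardinalities along the filtration *)

Lemma doubles_stable (G : zmodType) (Gf : nat -> set G) (K : set G) :
  finite_set (doubles G) -> finite_filtration Gf ->
  exists N, forall i z, (N <= i)%N -> K z ->
    exists w, [/\ K w, Gf i w & w *+ 2 = z *+ 2].
Proof.
move=> G2fin [_ Gf_inc Gf_cover].
have Gf_mono i j : (i <= j)%N -> Gf i `<=` Gf j.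
  move=> ij; rewrite -(subnK ij); elim: (j - i)%N => // k IHk x Gx.
  by rewrite addSn; apply/Gf_inc/IHk.
(* [ind d] is a stage at which [d] is already the double of an element of [K]; it is 0 when [d] is
   no such double. *)
have /choice[ind indP] (d : G) : exists j, (exists2 z, K z & z *+ 2 = d) ->
    exists w, [/\ K w, Gf j w & w *+ 2 = d].
  have [[z Kz zd]|nz] := pselect (exists2 z, K z & z *+ 2 = d); last by exists 0%N.
  have [j _ Gz] : (\bigcup_i Gf i) z by rewrite Gf_cover.
  by exists j => _; exists z.
(* Only finitely many doubles exist, so the largest of their stages serves for all. *)
exists (\max_(d : fset_set (doubles G)) ind (val d)) => i z Ni Kz.
have dz : z *+ 2 \in fset_set (doubles G) by rewrite in_fset_set// inE; exists z.
have [|w [Kw Gw wz]] := indP (z *+ 2); first by exists z.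
exists w; split => //; apply: Gf_mono Gw; apply: leq_trans Ni.
exact: (leq_bigmax_cond (F := fun d : fset_set (doubles G) => ind (val d)) [` dz]%fset).
Qed.

Definition two_torsion (G : zmodType) (H : {fset G}) : {fset G} :=
  [fset x in H | x *+ 2 == 0%R]%fset.

Lemma zmod_closed_two_torsion (G : zmodType) (H : {fset G}) :
  zmod_closed (mem H) -> zmod_closed (mem (two_torsion H)).
Proof.
move=> [H0 HB]; split=> [|x y]; rewrite !inE ?mul0rn ?eqxx ?andbT//.
move=> /andP[xH /eqP x2] /andP[yH /eqP y2].
by rewrite mulrnBl x2 y2 subrr eqxx andbT; apply: HB.
Qed.

(** Both 2-torsion parts have a power of 2 as cardinality, and the inclusion orders the exponents;
    [r] is their difference. *)
Lemma card_two_torsion_index (G : zmodType) (H H' : {fset G}) :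
  zmod_closed (mem H) -> zmod_closed (mem H') -> {subset H' <= H} ->
  exists r, #|` two_torsion H| = (2 ^ r * #|` two_torsion H'|)%N.
Proof.
move=> Hsub H'sub H'H.
have pow2 (S : {fset G}) : zmod_closed (mem S) ->
    exists a, #|` two_torsion S| = (2 ^ a)%N.
  move=> /zmod_closed_two_torsion Ssub; apply: card_fset_2torsion => //.
  by move=> x; rewrite !inE => /andP[_ /eqP].
have [[a Ha] [b H'b]] := (pow2 _ Hsub, pow2 _ H'sub).
have le_ba : (b <= a)%N.
  rewrite -(leq_exp2l (m := 2))// -Ha -H'b; apply/fsubset_leq_card/fsubsetP => x.
  by rewrite !inE => /andP[/H'H -> ->].
by exists (a - b)%N; rewrite Ha H'b -expnD subnK.
Qed.

Lemma card_double_two_torsion (G : zmodType) (H : {fset G}) :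
  zmod_closed (mem H) ->
  #|` H| = (#|` [fset (x *+ 2)%R | x in H]%fset| * #|` two_torsion H|)%N.
Proof.
by move=> Hsub; apply: card_fset_image_kernel => // x y; rewrite mulrnBl.
Qed.

Lemma zmod_closed_card_gt0 (G : zmodType) (H : {fset G}) :
  zmod_closed (mem H) -> (0 < #|` H|)%N.
Proof. by move=> [H0 _]; rewrite cardfs_gt0; apply/fset0Pn; exists 0. Qed.

(** With denominators cleared, the two inequalities place the density of [P] in [Gf i] between
    [2^(-r i) / |2G|] and [2^(-r i)]. Here [P] stands for the subset sums and [K] for the subgroup
    they generate. *)
Lemma eventual_card_bounds (G : zmodType) (Gf : nat -> set G) (K P : set G) :
  finite_set (doubles G) -> finite_filtration Gf ->
  subgroup K -> P `<=` K ->
  (forall x, K x -> exists p z, [/\ P p, K z & x = p + z *+ 2]) ->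
  exists (r : nat -> nat) N, {homo r : i j / (i <= j)%N} /\
    forall i, (N <= i)%N ->
      (card_set (Gf i) <=
         card_set (doubles G) * (2 ^ r i * card_set (P `&` Gf i)))%N /\
      (2 ^ r i * card_set (P `&` Gf i) <= card_set (Gf i))%N.
Proof.
move=> G2fin Gfilt Ksub PK Kmod2; have [Gfsub Gf_inc _] := Gfilt.
have [K0 KB] := Ksub.
have finGf i : finite_set (Gf i) by have [] := Gfsub i.
have finI S i : finite_set (S `&` Gf i) by apply: finite_setIr.
pose g i := fset_set (Gf i); pose k i := fset_set (K `&` Gf i).
have inG i x : (x \in g i) = (x \in Gf i) by rewrite in_fset_set.
have inK i x : (x \in k i) = (x \in K) && (x \in Gf i) by rewrite in_fset_set// in_setI.
have Gsub i : zmod_closed (mem (g i)).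
  have [[G0 GB] _] := Gfsub i; split=> [|x y]; rewrite /= !inG//; exact: GB.
have KGsub i : zmod_closed (mem (k i)).
  have [[G0 GB] _] := Gfsub i; split=> [|x y]; rewrite /= !inK.
    by apply/andP; split.
  by move=> /andP[xK xG] /andP[yK yG]; apply/andP; split; [apply: KB|apply: GB].
have subKG i : {subset k i <= g i} by move=> x; rewrite inK inG => /andP[].
have [r rE] := choice (fun i => card_two_torsion_index (Gsub i) (KGsub i) (@subKG i)).
(* Apply [leq_card_fset_index] inside [G_(i+1)[2]] to [G_i[2]] and [K_(i+1)[2]], which meet in
   [K_i[2]]. Cancelling the orders of [K_i[2]] and [K_(i+1)[2]] leaves [2^(r_i) <= 2^(r_(i+1))]. *)
have r_mono : {homo r : i j / (i <= j)%N}.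
  apply: homo_leq => [//|i j l|i]; first exact: leq_trans.
  have tG j := zmod_closed_two_torsion (Gsub j).
  have tK j := zmod_closed_two_torsion (KGsub j).
  have gS x : x \in g i -> x \in g i.+1 by rewrite !inG !inE; apply: Gf_inc.
  have tgS : {subset two_torsion (g i) <= two_torsion (g i.+1)}.
    by move=> x; rewrite !inE => /andP[/gS -> ->].
  have tkg : {subset two_torsion (k i.+1) <= two_torsion (g i.+1)}.
    by move=> x; rewrite !inE => /andP[/subKG -> ->].
  have tI : (two_torsion (g i) `&` two_torsion (k i.+1))%fset = two_torsion (k i).
    apply/fsetP => x; rewrite !inE !inK !inG; have := gS x; rewrite !inG.
    by case: (x \in Gf i) => [->//|_];
      case: (x \in K); case: (x *+ 2 == 0); rewrite ?andbF.
  have := leq_card_fset_index (tG i) (tK i.+1) (tG i.+1) tgS tkg.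
  rewrite tI !rE mulnAC.
  by rewrite !leq_pmul2r ?leq_exp2l ?zmod_closed_card_gt0.
have [N1 HN1] := doubles_stable [set: G] G2fin Gfilt.
have [N2 HN2] := doubles_stable K G2fin Gfilt.
(* Past [N1] one has [2G_i = 2G], and past [N2] one has [2K_i = 2K]. *)
exists r, (maxn N1 N2); split => // i; rewrite geq_max => /andP[iN1 iN2].
pose p := fset_set (P `&` Gf i).
rewrite /card_set -/(g i) -/p.
set D := #|` fset_set _|.
have gE : #|` g i| = (D * #|` two_torsion (g i)|)%N.
  rewrite card_double_two_torsion//; congr (_ * _)%N; congr #|` _|.
  apply/fsetP => d; rewrite in_fset_set//; apply/imfsetP/idP => /=.
    by move=> [x _ ->]; rewrite inE; exists x.
  rewrite inE => -[z _ <-]; have [w [_ Gw wz]] := HN1 i z iN1 I.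
  by exists w; rewrite ?inG ?inE.
set E := #|` [fset (x *+ 2)%R | x in k i]%fset|.
have kE : #|` k i| = (E * #|` two_torsion (k i)|)%N by rewrite card_double_two_torsion.
have ED : (E <= D)%N.
  apply/fsubset_leq_card/fsubsetP => d /imfsetP[/= x _ ->].
  by rewrite in_fset_set// inE; exists x.
have E0 : (0 < E)%N.
  by have := zmod_closed_card_gt0 (KGsub i); rewrite kE muln_gt0 => /andP[].
have pk : (#|` p| <= #|` k i|)%N.
  apply/fsubset_leq_card/fsubsetP => x; rewrite in_fset_set// inK !inE.
  by move=> [/PK Kx Gx]; apply/andP; split; apply/mem_set.
(* Addition maps [2K_i * (P meet G_i)] onto a set containing [K_i]: write [x = q + 2z] and replace
   [z] by [w] in [K_i] with the same double. Then [q = x - 2w] lies in [G_i] as well. *)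
have kp : (#|` k i| <= E * #|` p|)%N.
  rewrite -card_fsetM; set EP := (_ `*` _)%fset.
  have le_im : (#|` [fset (u.1 + u.2)%R | u in EP]%fset| <= #|` EP|)%N.
    exact: leq_imfset_card.
  apply: leq_trans le_im.
  apply/fsubset_leq_card/fsubsetP => x; rewrite inK => /andP[Kx Gx].
  have [q [z [Pq Kz xE]]] := Kmod2 x (set_mem Kx).
  have [w [Kw Gw wz]] := HN2 i z iN2 Kz.
  have kw : w \in k i by rewrite inK; apply/andP; split; apply/mem_set.
  apply/imfsetP; exists (w *+ 2, q); last by rewrite /= wz addrC.
  rewrite /= in_fsetM /=; apply/andP; split; first by apply/imfsetP; exists w.
  rewrite in_fset_set// inE; split => //; apply/set_mem.
  have [_ GB] := Gsub i.
  rewrite -inG (_ : q = x - w *+ 2); last by rewrite xE wz addrK.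
  have [_ GD] := GRing.zmod_closedD (Gsub i).
  have Gw' : w \in g i by rewrite inG; apply/mem_set.
  by apply: GB; [rewrite /= inG|rewrite mulr2n; apply: GD].
(* First bound: cancelling [E] in [E |K_i[2]| = |K_i| <= E |p|] gives [|K_i[2]| <= |p|]. Second
   bound: [|p| <= |K_i| = E |K_i[2]| <= D |K_i[2]|]. *)
split.
- rewrite gE leq_mul2l rE leq_mul2l expn_eq0/=; apply/orP; right.
  by rewrite -(leq_pmul2l E0) -kE.
- rewrite gE rE mulnCA leq_mul2l; apply/orP; right.
  by apply: (leq_trans pk); rewrite kE leq_mul2r ED orbT.
Qed.

(** * Densities and the conclusion *)

Lemma density_ge0 (R : realType) (G : zmodType) (Gf : nat -> set G) (S : set G) i :
  0 <= density R Gf S i.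
Proof. by rewrite divr_ge0. Qed.

Lemma bounded_density (R : realType) (G : zmodType) (Gf : nat -> set G) (S : set G) :
  finite_filtration Gf -> bounded_fun (density R Gf S).
Proof.
move=> [Gfsub _ _]; exists 1; split; first exact: num_real.
move=> M M1 i _ /=; apply: le_trans (ltW M1).
have [[G0 _] finG] := Gfsub i.
rewrite ger0_norm ?density_ge0// /density ler_pdivrMr ?mul1r ?ler_nat ?ltr0n.
  apply/fsubset_leq_card/fsubsetP => x.
  by rewrite !in_fset_set ?inE => [[]//|//|]; apply: finite_setIr.
by rewrite cardfs_gt0; apply/fset0Pn; exists 0; rewrite in_fset_set.
Qed.

(** If [r] is bounded, it attains a largest value, and monotonicity keeps it there from then on. The
    alternatives correspond to infinite and finite [m]. *)
Lemma nondecreasing_unbounded_or_stationary (r : nat -> nat) :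
  {homo r : i j / (i <= j)%N} ->
  (forall M, exists i, (M <= r i)%N) \/
  (exists m N, forall i, (N <= i)%N -> r i = m).
Proof.
move=> r_mono; have [|/existsNP[M rM]] := pselect (forall M, exists i, (M <= r i)%N).
  by left.
right; have rM' m : `[< exists i, r i = m >] -> (m <= M)%N.
  move=> /asboolP[i <-]; rewrite leqNgt; apply/negP => /ltnW Mr.
  by apply: rM; exists i.
have exr : exists m, `[< exists i, r i = m >].
  by exists (r 0); apply/asboolP; exists 0%N.
case: (ex_maxnP exr rM') => m /asboolP[N rN] maxm; exists m, N => i Ni.
apply/eqP; rewrite eqn_leq -[X in _ && (X <= _)%N]rN r_mono// andbT.
by apply: maxm; apply/asboolP; exists i.
Qed.

Theorem theorem1p4 (R : realType) (G : zmodType)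
    (Gcount : countable [set: G]) (Glf : locally_finite G)
    (G2fin : finite_set (doubles G))
    (Gf : nat -> set G) (Gfilt : finite_filtration Gf) (A : set G) :
  (exists m : option nat,
    [/\ inv_pow2 R m / (card_set (doubles G))%:R
          <= lower_density R Gf (subset_sums A),
        lower_density R Gf (subset_sums A)
          <= upper_density R Gf (subset_sums A) &
        upper_density R Gf (subset_sums A) <= inv_pow2 R m]) /\
  (upper_density R Gf (subset_sums A) > 2^-1 ->
   lower_density R Gf (subset_sums A) >= 1 / (card_set (doubles G))%:R).
Proof.
set P := subset_sums A; set D := card_set (doubles G).
suff main : exists m : option nat,
    [/\ inv_pow2 R m / D%:R <= lower_density R Gf P,
        lower_density R Gf P <= upper_density R Gf P &
        upper_density R Gf P <= inv_pow2 R m].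
  (* An upper density above 1/2 forces [m = 0]: every other [m], infinity included, has
     [2^(-m) <= 1/2]. *)
  split=> // up; have [[[|m]|] [lo _ hi]] := main.
  - by rewrite /= expr0 invr1 in lo.
  - have := lt_le_trans up hi; rewrite /= ltf_pV2 ?posrE ?exprn_gt0// ltNge.
    by rewrite exprS ler_peMr// exprn_ege1// ler1n.
  - by have := lt_le_trans up hi; rewrite /= ltNge invr_ge0 ler0n.
have ubnd := @bounded_density R G Gf P Gfilt.
have PK : P `<=` generated_subgroup A.
  exact: subset_sums_sub (subgroup_generated A) (@sub_gen_smallest _ _ A).
have [r [N [r_mono bnd]]] := eventual_card_bounds G2fin Gfilt
  (subgroup_generated A) PK (@generated_subgroup_mod2 _ A).
have D0 : (0 < D)%N.
  rewrite cardfs_gt0; apply/fset0Pn; exists 0.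
  by rewrite in_fset_set// inE; exists 0; rewrite // mul0rn.
have g0 i : 0 < (card_set (Gf i))%:R :> R.
  have [Gfsub _ _] := Gfilt; have [[G0 _] finG] := Gfsub i.
  by rewrite ltr0n cardfs_gt0; apply/fset0Pn; exists 0; rewrite in_fset_set.
have dlo i : (N <= i)%N -> 2 ^- r i / D%:R <= density R Gf P i.
  move=> /bnd[+ _]; rewrite -(ler_nat R) !natrM natrX => gle.
  rewrite /density ler_pdivlMr// mulrAC ler_pdivrMr ?ltr0n//.
  by rewrite ler_pdivrMl ?exprn_gt0// mulrA mulrC.
have dhi i : (N <= i)%N -> density R Gf P i <= 2 ^- r i.
  move=> /bnd[_]; rewrite -(ler_nat R) natrM natrX => gle.
  by rewrite /density ler_pdivrMr// ler_pdivlMl ?exprn_gt0.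
have [r_unb|[m [N' rm]]] := nondecreasing_unbounded_or_stationary r_mono.
  exists None; split; last 1 first.
  - rewrite /= leNgt; apply/negP => up0.
    (* This [M] is chosen so that the inverse of the upper density is below [2^M], that is, [2^(-M)]
       is below the upper density. But [r] eventually reaches [M], which bounds the upper density by
       [2^(-M)]. *)
    pose M := Num.bound (upper_density R Gf P)^-1.
    have [i Mi] := r_unb M.
    have : upper_density R Gf P <= 2 ^- M.
      apply: (limn_sup_le (N := maxn N i)) => // n; rewrite geq_max => /andP[Nn ni].
      apply: le_trans (dhi n Nn) _.
      rewrite lef_pV2 ?posrE ?exprn_gt0// ler_weXn2l ?ler1n//.
      exact: leq_trans Mi (r_mono _ _ ni).
    rewrite leNgt => /negP; apply.
    rewrite -[ltRHS]invrK ltf_pV2 ?posrE ?invr_gt0 ?exprn_gt0//.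
    exact: upper_nthrootP.
  - by rewrite /= mul0r; apply: (le_limn_inf (N := 0)) => // n _; apply: density_ge0.
  - exact: limn_inf_le_sup.
exists (Some m); split.
- apply: (le_limn_inf (N := maxn N N')) => // n; rewrite geq_max => /andP[Nn N'n].
  by rewrite /= -(rm n N'n) dlo.
- exact: limn_inf_le_sup.
- apply: (limn_sup_le (N := maxn N N')) => // n; rewrite geq_max => /andP[Nn N'n].
  by rewrite /= -(rm n N'n) dhi.
Qed.
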